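(* Let $h$ be the morphism on $\{0,1,2,3\}^*$ defined by $h(0)=01213012$, $h(1)=31$, $h(2)=01201312$, $h(3)=0121301312$, let $h^\omega(0)$ be its infinite fixed point starting with $0$, and let $g:\{0,1,2,3\}^*\to\{0,1,2\}^*$ be the morphism defined by $g(0)=0102012$, $g(1)=0212$, $g(2)=0121012$, $g(3)=01020121012$. Then the critical exponent of the infinite word $g(h^\omega(0))$ equals $\tfrac{41}{22}$.
   Context: For a nonempty finite word $u$ and a rational $e$, a word $v$ is the $e$-power $u^e$ of $u$ if $v$ is a prefix of the infinite periodic word $uuu\cdots$ and $e=|v|/|u|$. The critical exponent of an infinite word $\mathbf u$ is $E(\mathbf u)=\sup\{e\in\mathbb Q:\ v^e \text{ is a factor of } \mathbf u \text{ for some nonempty word } v\}$. Morphisms extend to infinite words by letterwise application and concatenation; $h^\omega(0)=\lim_{n\to\infty}h^n(0)$. *)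

(* Defs.v *)
From mathcomp Require Import all_boot all_order all_algebra.
From mathcomp Require Import classical_sets reals ereal.

Set Implicit Arguments.
Unset Strict Implicit.
Unset Printing Implicit Defensive.
Import GRing.Theory.

Local Open Scope classical_set_scope.
Local Open Scope ring_scope.

Definition infword (A : Type) := nat -> A.

Definition is_prefix (A : Type) (v : seq A) (w : infword A) : Prop :=
  v = mkseq w (size v).

Definition is_factor (A : Type) (v : seq A) (w : infword A) : Prop :=
  exists i, v = mkseq (fun k => w (i + k)%N) (size v).

(* The infinite word u u u ... ; the default x0 is irrelevant when u is not
   empty. *)
Definition periodic (A : Type) (x0 : A) (u : seq A) : infword A :=
  fun i => nth x0 u (i %% size u).

Definition is_power (A : Type) (u : seq A) (e : rat) (v : seq A) : Prop :=
  [/\ (0 < size u)%N,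
      forall x0, is_prefix v (periodic x0 u)
    & e = (size v)%:R / (size u)%:R].

(* The supremum is taken in the extended reals, since it may be infinite. *)
Definition critical_exponent (R : realType) (A : Type) (w : infword A)
    : \bar R :=
  ereal_sup [set (ratr e)%:E | e in
    [set e : rat | exists u v, is_power u e v /\ is_factor v w]].

(* The morphism of free monoids A^* -> B^* with images of letters given by f. *)
Definition morphism (A B : Type) (f : A -> seq B) (w : seq A) : seq B :=
  flatten (map f w).

(* When no f a is empty, the image of the first n+1 letters of w has at least
   n+1 letters, hence contains the letter of index n of the image of w, and the
   default y0 is never used (see image_infwordP). *)
Definition image_infword (A B : Type) (y0 : B) (f : A -> seq B)
    (w : infword A) : infword B :=
  fun n => nth y0 (morphism f (mkseq w n.+1)) n.

(* The limit of the words f^n(a), for a letter a such that f(a) = a s with s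
   not empty, and f nonerasing: then f^n(a) is a prefix of f^(n+1)(a) and has at
   least n+1 letters (see omega_wordP and image_omega_word). *)
Definition omega_word (A : Type) (f : A -> seq A) (a : A) : infword A :=
  fun n => nth a (iter n (morphism f) [:: a]) n.

Definition h (a : 'I_4) : seq 'I_4 :=
  nth [::] [:: [:: 0; 1; 2; 1; 3; 0; 1; 2];
               [:: 3; 1];
               [:: 0; 1; 2; 0; 1; 3; 1; 2];
               [:: 0; 1; 2; 1; 3; 0; 1; 3; 1; 2]] a.

Definition g (a : 'I_4) : seq 'I_3 :=
  nth [::] [:: [:: 0; 1; 0; 2; 0; 1; 2];
               [:: 0; 2; 1; 2];
               [:: 0; 1; 2; 1; 0; 1; 2];
               [:: 0; 1; 0; 2; 0; 1; 2; 1; 0; 1; 2]] a.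

Section Correctness.
Local Open Scope nat_scope.

Lemma morphism_cat (A B : Type) (f : A -> seq B) u v :
  morphism f (u ++ v) = morphism f u ++ morphism f v.
Proof. by rewrite /morphism map_cat flatten_cat. Qed.

Lemma leq_size_morphism (A B : Type) (f : A -> seq B) u :
  (forall a, 0 < size (f a)) -> size u <= size (morphism f u).
Proof.
move=> f0; elim: u => //= a u IH.
by rewrite size_cat -add1n leq_add.
Qed.

Lemma mkseq_prefix (A : Type) (w : infword A) m n :
  m <= n -> exists t, mkseq w n = mkseq w m ++ t.
Proof.
move=> /subnKC <-; rewrite /mkseq iotaD map_cat.
by exists [seq w i | i <- iota (0 + m) (n - m)].
Qed.

Lemma image_infwordP (A B : Type) (y0 : B) (f : A -> seq B) (w : infword A) m :
  (forall a, 0 < size (f a)) ->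
  is_prefix (morphism f (mkseq w m)) (image_infword y0 f w).
Proof.
move=> f0; apply: (@eq_from_nth _ y0); rewrite ?size_mkseq // => i im.
rewrite nth_mkseq // /image_infword.
have iS : i < size (morphism f (mkseq w i.+1)).
  by apply: leq_trans (leq_size_morphism _ f0); rewrite size_mkseq.
have [/mkseq_prefix-/(_ _ w)[t ->]|/ltnW/mkseq_prefix-/(_ _ w)[t E]] :=
  leqP i.+1 m.
  by rewrite morphism_cat nth_cat iS.
by rewrite E morphism_cat nth_cat im.
Qed.

Section Omega.
Variables (A : Type) (f : A -> seq A) (a : A) (s : seq A).
Hypotheses (f0 : forall b, 0 < size (f b)) (s0 : 0 < size s).
Hypothesis fa : f a = a :: s.

Let F n := iter n (morphism f) [:: a].

Lemma iter_morphism_prefix n :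
  exists t, [/\ 0 < size t & F n.+1 = F n ++ t].
Proof.
elim: n => [|n [t [t0 E]]].
  by exists s; split; rewrite //= /morphism /= fa cats0.
exists (morphism f t); split; first exact: leq_trans (leq_size_morphism t f0).
by have := morphism_cat f (F n) t; rewrite -E.
Qed.

Lemma ltn_size_iter_morphism n : n < size (F n).
Proof.
elim: n => // n IH; have [t [t0 ->]] := iter_morphism_prefix n.
by rewrite size_cat -addn1 leq_add.
Qed.

Lemma iter_morphism_prefix_le m n : m <= n -> exists t, F n = F m ++ t.
Proof.
move=> /subnKC <-; elim: (n - m) => [|k [t IH]].
  by exists [::]; rewrite addn0 cats0.
have [t' [_ E]] := iter_morphism_prefix (m + k).
by exists (t ++ t'); rewrite addnS E IH catA.
Qed.

Lemma omega_wordP n : is_prefix (F n) (omega_word f a).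
Proof.
apply: (@eq_from_nth _ a); rewrite ?size_mkseq // => i iF.
rewrite nth_mkseq // /omega_word -/(F i).
have [/iter_morphism_prefix_le[t E]|/ltnW/iter_morphism_prefix_le[t E]] :=
  leqP i n.
  by rewrite E nth_cat ltn_size_iter_morphism.
by rewrite E nth_cat iF.
Qed.

Lemma image_omega_word y0 : image_infword y0 f (omega_word f a) =1 omega_word f a.
Proof.
move=> n; have P := image_infwordP y0 (omega_word f a) (size (F n)) f0.
rewrite -omega_wordP -[morphism f (F n)]/(F n.+1) in P.
have nS : n < size (F n.+1) by apply: ltnW; exact: ltn_size_iter_morphism.
rewrite -(nth_mkseq y0 (image_infword y0 f (omega_word f a)) nS) -P.
by rewrite {1}omega_wordP nth_mkseq.
Qed.

End Omega.

Lemma h_gt0 b : 0 < size (h b).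
Proof. by case: b => [[|[|[|[|]]]]]. Qed.

Lemma g_gt0 b : 0 < size (g b).
Proof. by case: b => [[|[|[|[|]]]]]. Qed.

Lemma h0 : h 0%R = 0%R :: behead (h 0%R).
Proof. by []. Qed.

End Correctness.

(* Main.v *)
(** Let z = h^omega(0). A power of period p and length l + p in a word is an
    overlap: two occurrences, at distance p, of a word of length l; the exponent
    is 1 + l / p, so 22 l <= 19 p has to be shown in g(z). A long overlap
    contains boundaries between images of letters, which are recognizable, so it
    is up to a few letters at both ends the image of an overlap of z, and
    similarly for z = h(z). The weights 4, 1, 4, 5 of the letters satisfy
    wt(h(u)) = 6 wt(u) and |g(h(u))| = |g(u)| + 11 wt(u), so that a bound on
    overlaps with a sufficient margin propagates from periods of weight less
    than 684 to all longer ones. What remains is finite: the periods of weight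
    less than 684 in z, and the periods at most 198 in g(z), and it is decided by
    computing on the images of the factors of length 4 under h^3 and g h^2.
    The value 41/22 is reached by a factor of g(z) at position 93. *)

Require Import Defs.
From mathcomp Require Import all_boot all_order all_algebra.
From mathcomp Require Import classical_sets reals ereal.
From mathcomp Require Import zify.
From Stdlib Require Import BinNat.

Set Implicit Arguments.
Unset Strict Implicit.
Unset Printing Implicit Defensive.

(** * Morphisms on natural numbers, suited to computation; factors and prefix sums *)

Definition hN (a : nat) : seq nat :=
  nth [::] [:: [:: 0; 1; 2; 1; 3; 0; 1; 2]; [:: 3; 1];
               [:: 0; 1; 2; 0; 1; 3; 1; 2];
               [:: 0; 1; 2; 1; 3; 0; 1; 3; 1; 2]] a.

Definition gN (a : nat) : seq nat :=
  nth [::] [:: [:: 0; 1; 0; 2; 0; 1; 2]; [:: 0; 2; 1; 2];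
               [:: 0; 1; 2; 1; 0; 1; 2];
               [:: 0; 1; 0; 2; 0; 1; 2; 1; 0; 1; 2]] a.

(* A left eigenvector, for the eigenvalue 6, of the incidence matrix of h. *)
Definition wt (a : nat) : nat := nth 0 [:: 4; 1; 4; 5] a.

Definition factors4 : seq (seq nat) :=
  [:: [:: 0; 1; 2; 1]; [:: 1; 2; 1; 3]; [:: 2; 1; 3; 0]; [:: 1; 3; 0; 1];
      [:: 3; 0; 1; 2]; [:: 0; 1; 2; 3]; [:: 1; 2; 3; 1]; [:: 2; 3; 1; 0];
      [:: 3; 1; 0; 1]; [:: 1; 0; 1; 2]; [:: 0; 1; 2; 0]; [:: 1; 2; 0; 1];
      [:: 2; 0; 1; 3]; [:: 0; 1; 3; 1]; [:: 1; 3; 1; 2]; [:: 3; 1; 2; 3];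
      [:: 3; 0; 1; 3]; [:: 3; 1; 2; 0]; [:: 2; 0; 1; 2]].

Definition factor (A : Type) (w : infword A) i n : seq A :=
  mkseq (fun k => w (i + k)) n.

Definition overlap (w : infword nat) i j l : Prop :=
  forall k, k < l -> w (i + k) = w (j + k).

(** Weights of factors are differences of prefix sums; statements below are kept additive to avoid
    truncated subtraction. *)
Definition psum (v : nat -> nat) (w : infword nat) n :=
  sumn (map v (mkseq w n)).

Lemma factorD (A : Type) (w : infword A) i m n :
  factor w i (m + n) = factor w i m ++ factor w (i + m) n.
Proof.
rewrite /factor /mkseq iotaD map_cat; congr (_ ++ _).
by rewrite add0n -{1}[m]addn0 iotaDl -map_comp; apply: eq_map => k /=;
  rewrite addnA.
Qed.

Lemma take_factor (A : Type) (w : infword A) i m n :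
  m <= n -> take m (factor w i n) = factor w i m.
Proof. by move=> /subnKC <-; rewrite factorD take_size_cat // size_mkseq. Qed.

Lemma nth_factor (w : infword nat) i n k :
  k < n -> nth 0 (factor w i n) k = w (i + k).
Proof. exact: nth_mkseq. Qed.

Lemma factorS (A : Type) (w : infword A) i n :
  factor w i n.+1 = w i :: factor w i.+1 n.
Proof. by rewrite -add1n factorD /factor /mkseq /= addn0 addn1. Qed.

Lemma behead_factor (A : Type) (w : infword A) i n :
  behead (factor w i n) = factor w i.+1 n.-1.
Proof. by case: n => // n; rewrite factorS. Qed.

Lemma mkseqD (A : Type) (w : infword A) m n :
  mkseq w (m + n) = mkseq w m ++ factor w m n.
Proof. by rewrite -[LHS]/(factor w 0 _) factorD. Qed.

Lemma psumS v w n : psum v w n.+1 = psum v w n + v (w n).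
Proof. by rewrite /psum -addn1 mkseqD map_cat sumn_cat /= addn0 addn0. Qed.

Lemma psumD v w m n :
  psum v w (m + n) = psum v w m + sumn (map v (factor w m n)).
Proof. by rewrite /psum mkseqD map_cat sumn_cat. Qed.

Lemma leq_psum v w m n : m <= n -> psum v w m <= psum v w n.
Proof. by move=> /subnKC <-; rewrite psumD leq_addr. Qed.

Lemma leq_psumD v w b m n :
  (forall a, v a <= b) -> psum v w (m + n) <= psum v w m + b * n.
Proof.
move=> vb; elim: n => [|n IH]; first by rewrite addn0 leq_addr.
by rewrite addnS psumS mulnS; have := vb (w (m + n)); lia.
Qed.

Lemma eq_factor w i j l : overlap w i j l -> factor w i l = factor w j l.
Proof.
by move=> ov; apply/eq_in_map => k; rewrite mem_iota => /andP[_ /ov].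
Qed.

Lemma overlap_psum v w i j l k : overlap w i j l -> k <= l ->
  psum v w (i + k) + psum v w j = psum v w i + psum v w (j + k).
Proof.
move=> ov kl; rewrite !psumD (@eq_factor _ i j k); first by lia.
by move=> t tk; apply: ov; lia.
Qed.

(** * Block structure of the image of an infinite word *)

Section Image.
Variables (f : nat -> seq nat) (z w : infword nat).

Definition pos n := size (morphism f (mkseq z n)).
Definition is_image := forall n, is_prefix (morphism f (mkseq z n)) w.

Hypothesis im : is_image.

Lemma pos0 : pos 0 = 0. Proof. by []. Qed.

Lemma image_factor n q : factor w (pos n) (pos (n + q) - pos n)
  = morphism f (factor z n q).
Proof.
have E : morphism f (mkseq z (n + q)) =
    morphism f (mkseq z n) ++ morphism f (factor z n q).
  by rewrite mkseqD morphism_cat.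
have := im (n + q); rewrite /is_prefix {1}E (im n) -/(pos (n + q)) -/(pos n).
have -> : pos (n + q) = pos n + (pos (n + q) - pos n).
  by rewrite subnKC // /pos E size_cat leq_addr.
rewrite {1}mkseqD addKn => /eqP; rewrite eqseq_cat ?eqxx //=.
by move=> /eqP ->.
Qed.

Lemma posD n q : pos (n + q) = pos n + size (morphism f (factor z n q)).
Proof. by rewrite /pos mkseqD morphism_cat size_cat. Qed.

Lemma posS n : pos n.+1 = pos n + size (f (z n)).
Proof. by rewrite -addn1 posD /= /morphism /= cats0 addn0. Qed.

Lemma leq_pos m n : m <= n -> pos m <= pos n.
Proof. by move=> /subnKC <-; rewrite posD leq_addr. Qed.

Lemma drop_image n q k : k <= size (morphism f (factor z n q)) ->
  drop k (morphism f (factor z n q)) =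
  factor w (pos n + k) (size (morphism f (factor z n q)) - k).
Proof.
move=> kq; rewrite -image_factor posD addKn -{1}(subnKC kq) factorD.
by rewrite drop_size_cat // size_mkseq.
Qed.

Lemma window_image n q k l : k + l <= size (morphism f (factor z n q)) ->
  take l (drop k (morphism f (factor z n q))) = factor w (pos n + k) l.
Proof. by move=> kl; rewrite drop_image ?take_factor //; lia. Qed.

Lemma psum_pos v n : psum v w (pos n) = sumn (map v (morphism f (mkseq z n))).
Proof. by rewrite /psum im. Qed.

Lemma psum_posS v n :
  psum v w (pos n.+1) = psum v w (pos n) + sumn (map v (f (z n))).
Proof.
by rewrite !psum_pos -addn1 mkseqD morphism_cat map_cat sumn_cat
  /morphism /= cats0 addn0.
Qed.

Hypothesis f_gt0 : forall n, 0 < size (f (z n)).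

Lemma pos_block i : exists n k, i = pos n + k /\ k < size (f (z n)).
Proof.
elim: i => [|i [n [k [-> kn]]]]; first by exists 0, 0.
have [kS|kS] := ltnP k.+1 (size (f (z n))); first by exists n, k.+1; lia.
by exists n.+1, 0; rewrite posS; split; [lia|exact: f_gt0].
Qed.

End Image.

Lemma is_image_comp f1 f2 z w x :
  is_image f1 z w -> is_image f2 w x ->
  is_image (fun a => morphism f2 (f1 a)) z x.
Proof.
move=> im1 im2 n.
have -> : morphism (fun a => morphism f2 (f1 a)) (mkseq z n) =
    morphism f2 (morphism f1 (mkseq z n)).
  elim: (mkseq z n) => // a u IH.
  by rewrite -[morphism f1 _]/(f1 a ++ morphism f1 u) morphism_cat -IH.
by rewrite (im1 n); apply: im2.
Qed.

(** * Pulling overlaps back through a morphism *)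

Section Descent.
Variables (f : nat -> seq nat) (z w : infword nat) (L : nat).
Hypothesis im : is_image f z w.
Hypothesis L0 : 0 < L.
Hypothesis f_gt0 : forall n, 0 < size (f (z n)).
Hypothesis f_le : forall n, size (f (z n)) <= 11.
Local Notation P := (pos f z).

(* Whether a position is a boundary between two blocks f (z n) can be read off
   the 2 letters before it and the 3 letters after it; after a boundary, 8
   letters determine the next block, before a boundary, L letters determine the
   previous one. *)
Hypothesis sync : forall n m k, 0 < n -> 0 < m -> k < size (f (z m)) ->
  overlap w (P n - 2) (P m + k - 2) 5 -> k = 0.
Hypothesis right : forall n m, overlap w (P n) (P m) 8 -> z n = z m.
Hypothesis left : forall n m, n < m -> L <= P n.+1 ->
  overlap w (P n.+1 - L) (P m.+1 - L) L -> z n = z m.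

(** Equal blocks are peeled off one at a time; at most 7 remaining letters may fail to determine a
    block, hence the loss. *)
Lemma extend_right n m l : overlap w (P n) (P m) l ->
  exists q, overlap z n m q /\ P n + l < P (n + q) + 8.
Proof.
move: {2}l (leqnn l) => e; elim: e n m l => [|e IH] n m l le_l ov.
  by exists 0; split=> //; rewrite addn0; lia.
have [l8|l8] := ltnP l 8; first by exists 0; split=> //; rewrite addn0; lia.
have E : z n = z m by apply: right => k k8; apply: ov; lia.
have Sn := posS f z n; have Sm := posS f z m; rewrite -E in Sm.
have s0 := f_gt0 n.
have [||q [ovq lq]] := IH n.+1 m.+1 (l - size (f (z n))); [lia| |].
  by move=> k kl; rewrite Sn Sm -!addnA; apply: ov; lia.
exists q.+1; split; last by rewrite -(addSnnS n q); lia.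
by case=> [|k]; rewrite ?addn0 // !addnS -!addSn => /ovq.
Qed.

(** Blocks are compared backwards from matching boundaries while at least [L] letters of the overlap
    lie to the left. The last identity preserves the period, as measured by any letter weight, while
    the boundaries move. *)
Lemma extend_left i d l n m :
  overlap w i (i + d) l -> i <= P n <= i + l -> P m = P n + d -> n < m ->
  exists n' m' q, [/\ n = n' + q /\ m = m' + q, n' < m', overlap z n' m' q,
    P n' < i + L &
    forall v, psum v w (P n) + psum v w (P m') =
              psum v w (P n') + psum v w (P m)].
Proof.
move=> ov; elim: n m => [|n IH] m /andP[il nl] Em nm.
  by exists 0, m, 0; split; rewrite ?addn0 //; move: il; rewrite pos0; lia.
have [nL|nL] := ltnP (P n.+1) (i + L).
  by exists n.+1, m, 0; split; rewrite ?addn0 //; lia.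
case: m => // m in Em nm *.
have E : z n = z m.
  apply: left => //; first by lia.
  move=> k kL; have -> : P m.+1 - L + k = i + d + (P n.+1 - L + k - i) by lia.
  by rewrite -ov; [congr w|]; lia.
have Sn := posS f z n; have Sm := posS f z m; rewrite -E in Sm.
have Vn v := psum_posS im v n; have Vm v := psum_posS im v m.
(* A block straddling [i] is still kept, since its letter is known to agree; the extension then
   stops. *)
have [ni|ni] := ltnP (P n) i.
  exists n, m, 1; split; rewrite ?addn1 //; last 2 first; first by lia.
    by move=> v; rewrite Vn Vm E; lia.
  by case=> // _; rewrite !addn0.
have [|||n' [m' [q [[En Em'] nm' ovq ne V]]]] := IH m; try lia.
exists n', m', q.+1; split=> //; first by lia.
  move=> k; rewrite ltnS leq_eqVlt => /predU1P[->|/ovq//].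
  by rewrite -En -Em'.
by move=> v; have := V v; rewrite Vn Vm E; lia.
Qed.

(** A boundary near the start of the overlap is matched by [sync] with a boundary one period later;
    extending from this pair in both directions gives the overlap of [z]. *)
Lemma descent i j l : i < j -> 15 <= l -> overlap w i j l ->
  exists n m q, [/\ n < m, overlap z n m q,
    forall v, psum v w j + psum v w (P n) = psum v w i + psum v w (P m),
    P n < i + L & i + l < P (n + q) + 8].
Proof.
move=> ij l15 ov.
(* This block ends between [i + 2] and [i + 12], so the 2 letters before its end and the 3 after it
   fit in 15 letters. *)
have [n [k [En kn]]] := pos_block f_gt0 (i + 1).
have fn := f_le n; have Sn := posS f z n.
have [m [k' [Em km]]] := pos_block f_gt0 (P n.+1 + (j - i)).
have nm : n < m.
  rewrite ltnNge; apply/negP => mn; have := posS f z m.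
  by have /(leq_pos f z) := mn : m.+1 <= n.+1; lia.
have k0 : k' = 0.
  apply: (sync (n := n.+1) _ _ km) => //; first by lia.
  move=> t t5.
  have -> : P m + k' - 2 + t = j + (P n.+1 - 2 + t - i) by lia.
  rewrite -(ov (P n.+1 - 2 + t - i)); last by lia.
  by congr w; lia.
have {}nm : n.+1 < m.
  by rewrite ltnNge; apply/negP => /(leq_pos f z); lia.
have [||||n' [m' [q [[En' Em'] nm' ovq ne V]]]] :=
  @extend_left i (j - i) l n.+1 m _ _ _ _; rewrite ?subnKC //; try lia.
have [q' [ovq' lq']] : exists q', overlap z n.+1 m q' /\
    i + l < P (n.+1 + q') + 8.
  have [|q' [ovq' lq']] := @extend_right n.+1 m (i + l - P n.+1).
    move=> t tl; have -> : P m + t = j + (P n.+1 + t - i) by lia.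
    by rewrite -ov; [congr w|]; lia.
  by exists q'; split=> //; lia.
exists n', m', (q + q'); split=> //; last by rewrite addnA -En'.
  move=> t tq; have [/ovq //|qt] := ltnP t q.
  have := ovq' (t - q); rewrite En' Em' -!addnA subnKC //; apply; lia.
move=> v; have := V v.
have := @overlap_psum v w i j l (P n.+1 - i) ov.
have -> : i + (P n.+1 - i) = P n.+1 by lia.
have -> : j + (P n.+1 - i) = P m by lia.
by lia.
Qed.
End Descent.

(** * Recognizability reduced to checks on factors of length 4 *)

Section Synchronization.
Variables (f : nat -> seq nat) (z w : infword nat) (L : nat).
Hypothesis im : is_image f z w.
Hypothesis zP : forall n, factor z n 4 \in factors4.

Definition size_check := all (fun u =>
  [&& 2 <= size (f (nth 0 u 0)), 8 <= size (morphism f u),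
      L <= size (morphism f (take 2 u)) &
      size (morphism f (take 2 u)) + 3 <= size (morphism f u)]) factors4.

Definition sync_check := all (fun u => all (fun v => all (fun k =>
    (take 5 (drop (size (f (nth 0 u 0)) - 2) (morphism f u)) ==
     take 5 (drop (size (f (nth 0 v 0)) + k - 2) (morphism f v))) ==> (k == 0))
  (iota 0 (size (f (nth 0 v 1))))) factors4) factors4.

Definition right_check := all (fun u => all (fun v =>
    (take 8 (morphism f u) == take 8 (morphism f v)) ==>
    (nth 0 u 0 == nth 0 v 0)) factors4) factors4.

Definition suffix u (b : bool) :=
  let s := morphism f (take b.+1 u) in drop (size s - L) s.

(** The case [b = false] serves the first block of the word, which has no predecessor; the later
    block always has one. *)
Definition left_check := all (fun u => all (fun v => all (fun b : bool =>
    [&& L <= size (morphism f (take b.+1 u)) & suffix u b == suffix v true] ==>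
    (nth 0 u b == nth 0 v 1)) [:: false; true]) factors4) factors4.

Hypothesis sizeP : size_check.

Lemma sync_of_check : sync_check ->
  forall n m k, 0 < n -> 0 < m -> k < size (f (z m)) ->
  overlap w (pos f z n - 2) (pos f z m + k - 2) 5 -> k = 0.
Proof.
move=> /allP chk [//|n] [//|m] k _ _ km ov.
have /allP/(_ _ (zP m))/allP/(_ k) := chk _ (zP n).
have /and4P[un _ _ vn] := allP sizeP _ (zP n).
have /and4P[um _ _ vm] := allP sizeP _ (zP m).
rewrite take_factor // in vn vm.
rewrite nth_factor // addn0 in un; rewrite nth_factor // addn0 in um.
rewrite mem_iota !nth_factor // !addn0 addn1 add0n => /(_ km).
have Sn := posS f z n; have Sm := posS f z m.
have s2 t :
    size (morphism f (factor z t 2)) = size (f (z t)) + size (f (z t.+1)).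
  by rewrite /factor /mkseq /= addn0 addn1 /morphism /= cats0 size_cat.
rewrite !s2 in vn vm.
rewrite !(window_image im); [|lia|lia].
have -> : pos f z n + (size (f (z n)) - 2) = pos f z n.+1 - 2 by lia.
have -> : pos f z m + (size (f (z m)) + k - 2) = pos f z m.+1 + k - 2 by lia.
by rewrite (eq_factor ov) eqxx => /eqP.
Qed.

Lemma right_of_check : right_check ->
  forall n m, overlap w (pos f z n) (pos f z m) 8 -> z n = z m.
Proof.
move=> /allP chk n m ov.
have /allP/(_ _ (zP m)) := chk _ (zP n).
have /and4P[_ un _ _] := allP sizeP _ (zP n).
have /and4P[_ um _ _] := allP sizeP _ (zP m).
rewrite -[morphism f (factor z n 4)]drop0 -[morphism f (factor z m 4)]drop0.
rewrite !(window_image im) // !addn0 (eq_factor ov) eqxx implyTb.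
by rewrite !nth_factor // !addn0 => /eqP.
Qed.

Lemma suffixE n (b : bool) :
  L <= size (morphism f (take b.+1 (factor z n 4))) ->
  suffix (factor z n 4) b = factor w (pos f z (n + b).+1 - L) L.
Proof.
rewrite /suffix take_factor; last by case: b.
move=> Lb; rewrite (drop_image im) ?leq_subr //.
by rewrite subKn // -addnS posD addnBA.
Qed.

Lemma left_of_check : left_check -> forall n m, n < m -> L <= pos f z n.+1 ->
  overlap w (pos f z n.+1 - L) (pos f z m.+1 - L) L -> z n = z m.
Proof.
move=> /allP chk n [//|m] nm Ln ov.
have [n' [b [En Lb]]] : exists n' (b : bool), n = n' + b /\
    L <= size (morphism f (take b.+1 (factor z n' 4))).
  case: n => [|n] in nm Ln ov *.
    by exists 0, false; rewrite take_factor.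
  by exists n, true; rewrite addn1; have /and4P[] := allP sizeP _ (zP n).
have /allP/(_ _ (zP m))/allP/(_ b) := chk _ (zP n').
have /and4P[_ _ Lm _] := allP sizeP _ (zP m).
rewrite Lb !suffixE // -En addn1 (eq_factor ov) eqxx => /(_ _)/=.
have -> : b \in [:: false; true] by case: (b).
rewrite !nth_factor ?addn1 -?En; last by case: (b).
by move=> /(_ isT)/eqP.
Qed.

End Synchronization.

(** * The words [z] and [g(z)] and their recognizability *)

Definition zN : infword nat := fun n => omega_word h 0%R n.
Definition GN : infword nat :=
  fun n => image_infword 0%R g (omega_word h 0%R) n.

Lemma map_morphism (A B C D : Type) (p : A -> C) (q : B -> D)
    (f : A -> seq B) (f' : C -> seq D) u :
  (forall a, map q (f a) = f' (p a)) ->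
  map q (morphism f u) = morphism f' (map p u).
Proof.
move=> E; rewrite /morphism map_flatten -!map_comp; congr flatten.
exact: eq_map.
Qed.

Lemma map_mkseq (A B : Type) (q : A -> B) (w : nat -> A) n :
  map q (mkseq w n) = mkseq (fun k => q (w k)) n.
Proof. by rewrite /mkseq -map_comp. Qed.

Lemma val_h (a : 'I_4) : map val (h a) = hN (val a).
Proof. by case: a => [[|[|[|[|]]]]]. Qed.

Lemma val_g (a : 'I_4) : map val (g a) = gN (val a).
Proof. by case: a => [[|[|[|[|]]]]]. Qed.

Lemma image_zN : is_image hN zN zN.
Proof.
move=> n; have := image_infwordP 0%R (omega_word h 0%R) n h_gt0.
rewrite /is_prefix (eq_mkseq (image_omega_word h_gt0 _ h0 0%R)) // => E.
rewrite -[mkseq zN n]map_mkseq -(map_morphism _ val_h) {1}E map_mkseq.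
by rewrite size_map.
Qed.

Lemma image_GN : is_image gN zN GN.
Proof.
move=> n; have E := image_infwordP 0%R (omega_word h 0%R) n g_gt0.
rewrite /is_prefix -[mkseq zN n]map_mkseq -(map_morphism _ val_g) {1}E.
by rewrite map_mkseq size_map.
Qed.

Lemma zN_lt4 n : zN n < 4. Proof. exact: ltn_ord. Qed.

Lemma zN_all (p : pred nat) n : all p (iota 0 4) -> p (zN n).
Proof. by move=> /allP; apply; rewrite mem_iota zN_lt4. Qed.

Lemma size_hN n : 1 < size (hN (zN n)) <= 11.
Proof. exact: (zN_all (p := fun a => 1 < size (hN a) <= 11)). Qed.

Lemma size_gN n : 0 < size (gN (zN n)) <= 11.
Proof. exact: (zN_all (p := fun a => 0 < size (gN a) <= 11)). Qed.

Lemma hN_gt0 n : 0 < size (hN (zN n)).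
Proof. by have /andP[/ltnW] := size_hN n. Qed.

(** Strong induction: for [n > 0] the factor lies in the image of a factor at a smaller index, as
    images have at least 2 letters. *)
Lemma zN_factors4 n : factor zN n 4 \in factors4.
Proof.
have chk : all (fun u => all (fun k => (k + 4 <= size (morphism hN u)) &&
    (take 4 (drop k (morphism hN u)) \in factors4))
  (iota 0 (size (hN (nth 0 u 0))))) factors4 by vm_compute.
elim/ltn_ind: n => n IH.
have [m [k [En km]]] := pos_block hN_gt0 n.
have m2 : 2 * m <= pos hN zN m.
  elim: (m) => // t IHt; rewrite posS mulnS addnC leq_add //.
  by have /andP[] := size_hN t.
have [n0|n_gt0] := posnP n.
  have /(congr1 (take 4)) := image_factor image_zN 0 1.
  by rewrite take_factor ?n0 //.
have mn : m < n by lia.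
have /allP/(_ _ (IH m mn))/allP/(_ k) := chk.
rewrite nth_factor // addn0 mem_iota add0n => /(_ km)/andP[s4].
by rewrite (window_image image_zN) // -En.
Qed.

(** The images [h(2)] and [h(3)] share their last 5 letters, hence [L = 6]. *)
Lemma descent_h i j l : i < j -> 15 <= l -> overlap zN i j l ->
  exists n m q, [/\ n < m, overlap zN n m q,
    forall v, psum v zN j + psum v zN (pos hN zN n) =
              psum v zN i + psum v zN (pos hN zN m),
    pos hN zN n < i + 6 & i + l < pos hN zN (n + q) + 8].
Proof.
have S : size_check hN 6 by vm_compute.
apply: (descent image_zN) => //.
- exact: hN_gt0.
- by move=> n; have /andP[] := size_hN n.
- by apply: (sync_of_check image_zN zN_factors4 S); vm_compute.
- by apply: (right_of_check image_zN zN_factors4 S); vm_compute.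
- by apply: (left_of_check image_zN zN_factors4 S); vm_compute.
Qed.

(** The images [g(12)] and [g(3)] share their last 8 letters, hence [L = 9]. *)
Lemma descent_g i j l : i < j -> 15 <= l -> overlap GN i j l ->
  exists n m q, [/\ n < m, overlap zN n m q,
    forall v, psum v GN j + psum v GN (pos gN zN n) =
              psum v GN i + psum v GN (pos gN zN m),
    pos gN zN n < i + 9 & i + l < pos gN zN (n + q) + 8].
Proof.
have S : size_check gN 9 by vm_compute.
apply: (descent image_GN) => //.
- by move=> n; have /andP[] := size_gN n.
- by move=> n; have /andP[] := size_gN n.
- by apply: (sync_of_check image_GN zN_factors4 S); vm_compute.
- by apply: (right_of_check image_GN zN_factors4 S); vm_compute.
- by apply: (left_of_check image_GN zN_factors4 S); vm_compute.
Qed.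

(** * Weights, image lengths and the induction step for long periods *)

Definition glen (a : nat) : nat := size (gN a).

Local Notation X := (psum wt zN).
Local Notation Y := (psum glen zN).

Lemma wt_le a : wt a <= 5.
Proof. by case: a => [|[|[|[|a]]]] //; rewrite /wt /= nth_nil. Qed.

Lemma glen_le a : glen a <= 11.
Proof. by case: a => [|[|[|[|a]]]] //; rewrite /glen /gN /= nth_nil. Qed.

(** Each letter satisfies [7/4 wt <= glen <= 4 wt]. *)
Lemma glen_wt i j : i <= j ->
  7 * X j + 4 * Y i <= 4 * Y j + 7 * X i /\ Y j + 4 * X i <= 4 * X j + Y i.
Proof.
move=> /subnKC <-; elim: (j - i) => [|k IH]; first by rewrite addn0; lia.
rewrite addnS !psumS.
have /andP[] := zN_all
  (p := fun a => (7 * wt a <= 4 * glen a) && (glen a <= 4 * wt a))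
  (i + k) isT.
by lia.
Qed.

Lemma psum_glen n : Y n = pos gN zN n.
Proof.
by elim: n => // n IH; rewrite psumS posS IH.
Qed.

Lemma psum_const1 w n : psum (fun=> 1) w n = n.
Proof. by elim: n => // n IH; rewrite psumS IH addn1. Qed.

Lemma wt_pos n : X (pos hN zN n) = 6 * X n.
Proof.
elim: n => // n IH; rewrite (psum_posS image_zN) psumS IH mulnDr; congr (_ + _).
exact/eqP/(zN_all (p := fun a => sumn (map wt (hN a)) == 6 * wt a)).
Qed.

Lemma glen_pos n : Y (pos hN zN n) = Y n + 11 * X n.
Proof.
elim: n => // n IH; rewrite (psum_posS image_zN) !psumS IH.
have /eqP -> := zN_all
  (p := fun a => sumn (map glen (hN a)) == glen a + 11 * wt a) n isT.
by lia.
Qed.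

(* An overlap of weight W with a period of weight P in z pulls back through h
   to an overlap of weight at least (W - 60) / 6 with a period of weight P / 6,
   because at most 5 + 7 letters of weight at most 5 are lost at the ends. The
   margin 264 = 22 * 60 / 5 is the fixed point of this recursion; the margin
   330 = 22 * 15 pays for the 8 + 7 letters lost when pulling back through g. *)
Definition short_overlap i j l :=
  (22 * X (i + l) + 264 + 19 * X i <= 19 * X j + 22 * X i) &&
  (22 * Y (i + l) + 330 + 19 * Y i <= 19 * Y j + 22 * Y i).

(* As |g(u)| >= 7/4 wt(u), a period of weight at least 684 pulls back to a
   period of weight at least 114, whose image under g has more than 198
   letters. *)
Lemma short_overlap_step i j l :
  (forall n m q, n < m -> overlap zN n m q -> 199 + Y n <= Y m ->
     X m - X n < X j - X i -> short_overlap n m q) ->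
  i < j -> overlap zN i j l -> 684 + X i <= X j -> short_overlap i j l.
Proof.
move=> IH ij ov Xij; rewrite /short_overlap.
have [l15|l15] := ltnP l 15.
  have := leq_psumD zN i l wt_le; have := leq_psumD zN i l glen_le.
  by have := glen_wt (ltnW ij); lia.
have [n [m [q [nm ovq V ni iq]]]] := descent_h ij l15 ov.
have := V wt; have := V glen; rewrite !wt_pos !glen_pos => VY VX.
have [G1 _] := glen_wt (ltnW nm).
have /andP[] : short_overlap n m q by apply: IH => //; lia.
have := leq_psumD zN i 5 wt_le; have := leq_psumD zN i 5 glen_le.
have /(leq_psum wt zN) := (ltac:(lia) : pos hN zN n <= i + 5).
have /(leq_psum glen zN) := (ltac:(lia) : pos hN zN n <= i + 5).
have := leq_psumD zN (pos hN zN (n + q)) 7 wt_le.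
have := leq_psumD zN (pos hN zN (n + q)) 7 glen_le.
have /(leq_psum wt zN) := (ltac:(lia) : i + l <= pos hN zN (n + q) + 7).
have /(leq_psum glen zN) := (ltac:(lia) : i + l <= pos hN zN (n + q) + 7).
by rewrite !wt_pos !glen_pos; lia.
Qed.

(** * Computation for periods of weight below 684 in [z] *)

Section Lcp.
Variables (A : Type) (e : rel A).

(** Running out of letters gives [false], so success always exhibits a mismatch. *)
Fixpoint lcp_lt n (s t : seq A) : bool :=
  if n is n'.+1 then
    match s, t with
    | a :: s', b :: t' => if e a b then lcp_lt n' s' t' else true
    | _, _ => false
    end
  else false.

Lemma lcp_ltP w n i j p q : lcp_lt n (factor w i p) (factor w j q) ->
  exists2 k, k < n & ~~ e (w (i + k)) (w (j + k)).
Proof.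
elim: n i j p q => // n IH i j [|p] [|q] //; rewrite ?factorS //=.
case: ifPn => [_ /IH[k kn kE]|]; first by exists k.+1; rewrite // -!addSnnS.
by exists 0; rewrite ?addn0.
Qed.

End Lcp.

Lemma overlap_le w i j l k :
  overlap w i j l -> w (i + k) != w (j + k) -> l <= k.
Proof. by move=> ov; rewrite leqNgt; apply: contraNN => /ov ->. Qed.

(* Each letter is paired with the weight and the image length of what precedes
   it, in binary, so that those of any factor are obtained by a subtraction. *)
Fixpoint annot x y (s : seq nat) : seq (nat * (N * N)) :=
  if s is a :: s' then
    (a, (x, y)) :: annot (N.add x (N.of_nat (wt a)))
                         (N.add y (N.of_nat (glen a))) s'
  else [::].

Fixpoint walk b1 b2 (s t : seq (nat * (N * N))) : bool :=
  match s, t with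
  | (a, (x, y)) :: s', (b, _) :: t' =>
    if eqn a b then walk b1 b2 s' t'
    else N.leb (N.mul 22 x) b1 && N.leb (N.mul 22 y) b2
  | _, _ => false
  end.

(* The conditionals are not written with ||, whose second argument would always
   be evaluated by vm_compute. *)
Definition zpair (s t : seq (nat * (N * N))) : bool :=
  if lcp_lt (fun a b => eqn a.1 b.1) 6 s t then true else
  match s, t with
  | (_, (x0, y0)) :: _, (_, (x1, y1)) :: _ =>
    if N.ltb y1 (N.add 199 y0) then true else
    let xl := N.add 264 (N.mul 19 x0) in
    let xr := N.add (N.mul 19 x1) (N.mul 22 x0) in
    let yl := N.add 330 (N.mul 19 y0) in
    let yr := N.add (N.mul 19 y1) (N.mul 22 y0) in
    [&& N.leb xl xr, N.leb yl yr & walk (N.sub xr xl) (N.sub yr yl) s t]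
  | _, _ => false
  end.

(** When the fuel [n] runs out, the period must weigh at least 684, so no lighter period is
    skipped. *)
Fixpoint zscan n (s t : seq (nat * (N * N))) : bool :=
  match n, t with
  | n'.+1, _ :: t' => zpair s t && zscan n' s t'
  | 0, (_, (x1, _)) :: _ =>
    if s is (_, (x0, _)) :: _ then N.leb (N.add 684 x0) x1 else false
  | _, [::] => false
  end.

Fixpoint zrows n (s : seq (nat * (N * N))) : bool :=
  if n is n'.+1 then zscan 240 s (behead s) && zrows n' (behead s) else true.

Section ScanSoundness.
Variables c d : nat.

(** [annot] counts from 0 at the start of a window, where the true prefix sums are [c] and [d]. *)
Definition annotated (n : nat) : nat * (N * N) :=
  (zN n, (N.of_nat (X n - c), N.of_nat (Y n - d))).

Lemma annotE i n : c <= X i -> d <= Y i ->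
  annot (N.of_nat (X i - c)) (N.of_nat (Y i - d)) (factor zN i n) =
  factor annotated i n.
Proof.
elim: n i => // n IH i ci di; rewrite !factorS /= -IH.
- by rewrite !psumS; congr (_ :: annot _ _ _); lia.
- by rewrite psumS; lia.
- by rewrite psumS; lia.
Qed.

Lemma walk_cons b1 b2 a b s t : walk b1 b2 (a :: s) (b :: t) =
  if eqn a.1 b.1 then walk b1 b2 s t
  else N.leb (N.mul 22 a.2.1) b1 && N.leb (N.mul 22 a.2.2) b2.
Proof. by case: a => [? []]; case: b. Qed.

Lemma walkP b1 b2 i j p q :
  walk b1 b2 (factor annotated i p) (factor annotated j q) ->
  exists k, [/\ zN (i + k) != zN (j + k),
    N.le (N.of_nat (22 * (X (i + k) - c))) b1 &
    N.le (N.of_nat (22 * (Y (i + k) - d))) b2].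
Proof.
elim: p i j q => // p IH i j [|q]; rewrite !factorS // walk_cons.
case: eqnP => [_ /IH[k]|/eqP ij].
  by rewrite !addSnnS; exists k.+1.
move=> /andP[/N.leb_le bX /N.leb_le bY]; exists 0; rewrite !addn0.
have {}bX : N.le (N.mul 22 (N.of_nat (X i - c))) b1 := bX.
have {}bY : N.le (N.mul 22 (N.of_nat (Y i - d))) b2 := bY.
by split=> //; lia.
Qed.

Lemma zpairP i j l p q : c <= X i -> d <= Y i -> i < j -> overlap zN i j l ->
  199 + Y i <= Y j -> zpair (factor annotated i p) (factor annotated j q) ->
  short_overlap i j l.
Proof.
move=> ci di ij ov Yij; rewrite /zpair /short_overlap.
have [_ Xij] := glen_wt (ltnW ij).
have cj := leq_psum wt zN (ltnW ij); have dj := leq_psum glen zN (ltnW ij).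
case: ifP => [/lcp_ltP[k k6 /= ne]|_].
  have lk : l <= k.
    by apply: overlap_le ov _; apply: contraNneq ne => ->; apply/eqnP.
  (* At most 5 letters overlap, and a period of image length at least 199 weighs at least 50: both
     margins hold. *)
  have := leq_psumD zN i l wt_le; have := leq_psumD zN i l glen_le.
  by lia.
case: p => // p; case: q => // q.
rewrite !factorS [annotated i]/annotated [annotated j]/annotated.
case: ifP => [/N.ltb_lt|_]; first by lia.
rewrite -[(zN i, _)]/(annotated i) -[(zN j, _)]/(annotated j) -!factorS.
move=> /and3P[/N.leb_le bX /N.leb_le bY /walkP[k [ne wX wY]]].
have lk := overlap_le ov ne.
have /(leq_psum wt zN) := (ltac:(lia) : i + l <= i + k).
have /(leq_psum glen zN) := (ltac:(lia) : i + l <= i + k).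
have := leq_psum wt zN (leq_addr l i); have := leq_psum glen zN (leq_addr l i).
by lia.
Qed.

Lemma zscanP i j m l n p q : c <= X i -> d <= Y i -> i < j <= m ->
  overlap zN i m l -> X m < 684 + X i -> 199 + Y i <= Y m ->
  zscan n (factor annotated i p) (factor annotated j q) -> short_overlap i m l.
Proof.
move=> ci di /andP[ij jm] ov Xm Ym; elim: n j q ij jm => [|n IH] j q ij jm.
  case: q => // q; case: p => // p; rewrite !factorS => /N.leb_le.
  by have := leq_psum wt zN jm; lia.
case: q => // q; rewrite factorS => /andP[]; rewrite -factorS => zp zs.
move: jm; rewrite leq_eqVlt => /predU1P[E|jm]; last first.
  by apply: (IH _ _ _ jm zs); lia.
by subst m; apply: zpairP ov Ym zp => //; lia.
Qed.

Lemma zrowsP n i k p : k < n -> zrows n (factor annotated i p) ->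
  exists q, zscan 240 (factor annotated (i + k) q.+1)
                      (factor annotated (i + k).+1 q).
Proof.
elim: n i k p => // n IH i k [|p] kn /andP[] //.
rewrite behead_factor => zs zr; case: k kn => [|k] kn.
  by exists p; rewrite addn0.
by rewrite -addSnnS; apply: IH zr.
Qed.

End ScanSoundness.

Definition h3 a := morphism hN (morphism hN (hN a)).

(** Starting positions range over the image of the first letter; the other three leave room for the
    second occurrence. *)
Definition zcheck u :=
  zrows (size (h3 (nth 0 u 0))) (annot 0 0 (morphism h3 u)).

Lemma zcheck_factors4 : all zcheck factors4.
Proof. by vm_cast_no_check (erefl true). Qed.

Lemma image_h3 : is_image h3 zN zN.
Proof.
exact: is_image_comp (is_image_comp image_zN image_zN) image_zN.
Qed.

Lemma h3_gt0 n : 0 < size (h3 (zN n)).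
Proof. exact: (zN_all (p := fun a => 0 < size (h3 a))). Qed.

Lemma short_overlap_base i j l : i < j -> overlap zN i j l ->
  X j < 684 + X i -> 199 + Y i <= Y j -> short_overlap i j l.
Proof.
move=> ij ov Xij Yij.
have [n [k [Ei kn]]] := pos_block h3_gt0 i.
have := allP zcheck_factors4 _ (zN_factors4 n).
rewrite /zcheck nth_factor // addn0 -(image_factor image_h3).
set r := pos h3 zN n in Ei *.
have := @annotE (X r) (Y r) r (pos h3 zN (n + 4) - r) (leqnn _) (leqnn _).
rewrite !subnn => -> /(zrowsP kn)[q]; rewrite -Ei => zs.
apply: zscanP ov Xij Yij zs; rewrite ?leqnn ?andbT ?ltnSn //;
  by apply: leq_psum; lia.
Qed.

(** Induction on the weight of the period, which descent through [h] divides by 6. *)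
Lemma zN_overlap i j l : i < j -> overlap zN i j l -> 199 + Y i <= Y j ->
  short_overlap i j l.
Proof.
move: {2}(X j - X i).+1 (ltnSn (X j - X i)) => b.
elim: b i j l => // b IH i j l Xb ij ov Yij.
have [Xij|Xij] := ltnP (X j) (684 + X i); first exact: short_overlap_base.
apply: short_overlap_step ij ov Xij => n m q nm ovq Ynm Xnm.
by apply: IH ovq Ynm => //; lia.
Qed.

(** * Computation for periods at most 198 in [g(z)] *)

(** [ks] lists the longest overlaps allowed for successive periods. *)
Fixpoint gscan ks (s t : seq nat) : bool :=
  if ks is n :: ks' then lcp_lt eqn n.+1 s t && gscan ks' s (behead t)
  else true.

Fixpoint grows ks n (s : seq nat) : bool :=
  if n is n'.+1 then gscan ks s (behead s) && grows ks n' (behead s) else true.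

Lemma gscanP ks w i j l p q k : k < size ks -> overlap w i (j + k) l ->
  gscan ks (factor w i p) (factor w j q) -> l <= nth 0 ks k.
Proof.
elim: ks j q k => // n ks IH j q k kn ov /andP[/lcp_ltP[t tn ne]].
rewrite behead_factor; case: k => [|k] in kn ov *.
  by rewrite addn0 in ov => _; apply: leq_trans (overlap_le ov ne) _.
by rewrite -addSnnS in ov; apply: IH.
Qed.

Lemma growsP ks n w i p k : k < n -> grows ks n (factor w i p) ->
  exists q r, gscan ks (factor w (i + k) q) (factor w (i + k).+1 r).
Proof.
elim: n i p k => // n IH i p k kn; rewrite [grows _ _ _]/= behead_factor.
move=> /andP[gs gr]; case: k kn => [|k] kn.
  by exists p, p.-1; rewrite addn0.
by rewrite -addSnnS; apply: IH gr.
Qed.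

Definition gh2 a := morphism gN (morphism hN (hN a)).

Definition gcheck ks u := grows ks (size (gh2 (nth 0 u 0))) (morphism gh2 u).

Lemma gcheck_factors4 :
  all (gcheck [seq 19 * p %/ 22 | p <- iota 1 198]) factors4.
Proof. by vm_cast_no_check (erefl true). Qed.

Lemma image_gh2 : is_image gh2 zN GN.
Proof.
exact: is_image_comp (is_image_comp image_zN image_zN) image_GN.
Qed.

Lemma gh2_gt0 n : 0 < size (gh2 (zN n)).
Proof. exact: (zN_all (p := fun a => 0 < size (gh2 a))). Qed.

(* The period 198 has an overlap of length 165 in g(z), too long for the
   margins of short_overlap: this is what sets the threshold between the direct
   computation in g(z) and the descent to z. *)
Lemma GN_overlap_base i p l : 0 < p <= 198 -> overlap GN i (i + p) l ->
  22 * l <= 19 * p.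
Proof.
case: p => // p p198 ov; rewrite mulnC -leq_divRL //.
have [n [k [Ei kn]]] := pos_block gh2_gt0 i.
have := allP gcheck_factors4 _ (zN_factors4 n).
rewrite /gcheck nth_factor // addn0 -(image_factor image_gh2).
move=> /(growsP kn)[q [r]]; rewrite -Ei -addSnnS in ov * => gs.
have := gscanP _ ov gs; rewrite size_map size_iota => /(_ p198).
by rewrite (nth_map 0) ?size_iota // nth_iota.
Qed.

(** * From overlaps to the critical exponent *)

Lemma GN_overlap i j l : i < j -> overlap GN i j l -> 22 * l <= 19 * (j - i).
Proof.
move=> ij ov; have [p198|p199] := leqP (j - i) 198.
  by apply: (@GN_overlap_base i); rewrite ?subnKC //; lia.
have [l15|l15] := ltnP l 15; first by lia.
have [n [m [q [nm ovq V ni iq]]]] := descent_g ij l15 ov.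
(* For the constant weight 1, [V] equates the period [j - i] with the image length of the period in
   [z]. *)
have := V (fun=> 1); rewrite !psum_const1 => Vnm.
have /andP[_] : short_overlap n m q.
  by apply: zN_overlap => //; rewrite !psum_glen; lia.
by rewrite !psum_glen; lia.
Qed.

Lemma power_size_le (u v : seq 'I_3) e :
  is_power u e v -> is_factor v (image_infword 0%R g (omega_word h 0%R)) ->
  22 * size v <= 41 * size u.
Proof.
move=> [u0 pv _] [i fv]; have [vu|uv] := leqP (size v) (size u); first by lia.
have w_nth k : k < size v -> image_infword 0%R g (omega_word h 0%R) (i + k)
    = nth 0%R u (k %% size u).
  move=> kv; have /(congr1 (fun s => nth 0%R s k)) := pv 0%R.
  by rewrite {1}fv !nth_mkseq.
have ov : overlap GN i (i + size u) (size v - size u).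
  move=> k kl; rewrite /GN -addnA !w_nth; [|lia|lia].
  by rewrite modnDl.
by have := GN_overlap (ltac:(lia) : i < i + size u) ov; lia.
Qed.

Lemma power_41_22 : exists u v : seq 'I_3, is_power u (41%:R / 22%:R)%R v /\
  is_factor v (image_infword 0%R g (omega_word h 0%R)).
Proof.
pose w k := image_infword 0%R g (omega_word h 0%R) (93 + k).
exists (mkseq w 22), (mkseq w 41); split; last by exists 93; rewrite size_mkseq.
(* The two sides of the last equation evaluate to the same word. *)
by split; rewrite ?size_mkseq // => x0; rewrite /is_prefix size_mkseq.
Qed.

Import Order.TTheory GRing.Theory Num.Theory.

Theorem theorem14 (R : realType) :
  critical_exponent R (A := 'I_3) (image_infword 0%R g (omega_word h 0%R))
  = ((41%:R / 22%:R)%R)%:E.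
Proof.
have ratrE (a b : nat) : ratr (a%:R / b%:R)%R = (a%:R / b%:R)%R :> R.
  by rewrite fmorph_div !rmorph_nat.
apply/eqP; rewrite eq_le; apply/andP; split.
  apply: ge_ereal_sup => _ [e [u [v [pw fa]]] <-].
  have := power_size_le pw fa; have [u0 _ ->] := pw.
  rewrite ratrE lee_fin ler_pdivrMr ?ltr0n // mulrAC ler_pdivlMr ?ltr0n //.
  by rewrite -!natrM ler_nat mulnC.
have [u [v [pw fa]]] := power_41_22.
apply: ereal_sup_ubound; exists (41%:R / 22%:R)%R; last by rewrite ratrE.
by exists u, v.
Qed.
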